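(* Let $a\ne0$, $b,c,d,e,\delta$ be real with $d+e-b-c>0$, $b>0$, $c>0$, $\delta>0$ and $\min(b,c)<\min(d,e)$. Define for $x>-1$ $$ f(x)=\frac{{}_3F_2(a,b+\delta,c+\delta;d+\delta,e+\delta;-x)}{{}_3F_2(a,b,c;d,e;-x)}. $$ Then $f$ is monotone decreasing on $(-1,\infty)$ if $a>0$ and monotone increasing on $(-1,\infty)$ if $a<0$.
   Context: ${}_3F_2(\alpha_1,\alpha_2,\alpha_3;\beta_1,\beta_2;z)=\sum_{n\ge0}\frac{(\alpha_1)_n(\alpha_2)_n(\alpha_3)_n}{(\beta_1)_n(\beta_2)_n n!}z^n$ with $(a)_n=a(a+1)\cdots(a+n-1)$, analytically continued to $\mathbb C\setminus[1,\infty)$. *)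

(* Defs.v *)
From Stdlib Require Import Reals.
From Coquelicot Require Import Coquelicot.
Open Scope R_scope.

Fixpoint poch (a : R) (n : nat) : R :=
  match n with
  | O => 1
  | S k => poch a k * (a + INR k)
  end.

Definition hyp32_term (a1 a2 a3 b1 b2 z : R) (n : nat) : R :=
  poch a1 n * poch a2 n * poch a3 n / (poch b1 n * poch b2 n * INR (Factorial.fact n))
  * z ^ n.

Definition real_analytic_on (D : R -> Prop) (g : R -> R) : Prop :=
  forall x0, D x0 -> exists r, 0 < r /\ exists c : nat -> R,
    forall x, Rabs (x - x0) < r -> is_series (fun n => c n * (x - x0) ^ n) (g x).

(* g is (the restriction to the real half-line (-oo,1) of) the analytic
   continuation of 3F2(a1,a2,a3;b1,b2;z): it is real-analytic on (-oo,1)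
   and coincides with the power series on (-1,1).  By the identity theorem
   on the connected set (-oo,1) such a g is unique. *)
Definition is_3F2 (a1 a2 a3 b1 b2 : R) (g : R -> R) : Prop :=
  real_analytic_on (fun z => z < 1) g /\
  forall z, -1 < z < 1 -> is_series (hyp32_term a1 a2 a3 b1 b2 z) (g z).

(* Main.v *)
Require Import Defs.
From Stdlib Require Import Reals Lra Lia Factorial.
From Coquelicot Require Import Coquelicot.
Open Scope R_scope.

(* There is a probability measure mu on [0,1] with
     F(z) = int (1 - s z)^(-a) dmu(s),
   and the shift by delta replaces mu by a multiple of s^delta mu; so G/F is
   the mean of the increasing function s^delta under the weights
   (1 - s z)^(-a), and Chebyshev's inequality gives its monotonicity in z.
   The measure is handled only through its mixed moments
   P k j = int s^k (1-s)^j dmu, which are convergent positive series, and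
   through the Bernstein sums these define; "the density ratio s^delta is
   increasing" becomes monotonicity in k of the ratio of the two families at
   fixed k + j.  The Bernstein sums of (1 - s z)^(-a) converge for all z < 1 to
   a function analytic at every z <= 0, which the identity theorem equates
   with F. *)

(** The density of [mu] may be singular at both endpoints, and its normalization involves Gamma
    values. Moments avoid both: every entry is a positive series and only ratios of entries matter.
    Positivity is where [min(b,c) < min(d,e)] enters: with [b] the smaller numerator parameter,
    [d - b] and [e - b] are positive, so the density expands into Beta densities with positive
    coefficients. The inequalities are proved for finite sums by one Chebyshev argument used twice:
    over the index of the Beta mixture, to compare the two arrays, and over the Bernstein nodes, to
    compare [G/F] at two points. They are not strict, so they survive the limits; only the
    denominator [F] needs a bound away from zero. The power series says nothing for [z <= -1], hence
    the kernel is re-expanded around every [z0 <= 0], with radius [1 - z0]. *)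

(** * Preliminaries: dominated convergence for series, binomial coefficients *)

Lemma is_series_sum_f_R0 (u : nat -> R) (l : R) :
  is_series u l <-> is_lim_seq (sum_f_R0 u) l.
Proof.
  split; intros H.
  - apply is_lim_seq_Reals, is_series_Reals, H.
  - apply is_series_Reals, is_lim_seq_Reals, H.
Qed.

Lemma is_lim_seq_sum_f_R0 (x : nat -> nat -> R) (l : nat -> R) (K : nat) :
  (forall n, (n <= K)%nat -> is_lim_seq (fun N => x N n) (l n)) ->
  is_lim_seq (fun N => sum_f_R0 (x N) K) (sum_f_R0 l K).
Proof.
  induction K as [|K IH]; simpl; intros H; auto.
  apply is_lim_seq_plus'; auto.
Qed.

Lemma is_series_Rmult_l (m : R) (u : nat -> R) (l : R) :
  is_series u l -> is_series (fun n => m * u n) (m * l).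
Proof. exact (is_series_scal_l m u l). Qed.

Lemma is_series_Rext (u v : nat -> R) (l : R) :
  (forall n, u n = v n) -> is_series u l -> is_series v l.
Proof. exact (is_series_ext u v l). Qed.

Lemma dominated_ex_series (u M : nat -> R) :
  ex_series M -> (forall n, Rabs (u n) <= M n) -> ex_series u.
Proof. intros HM H; exact (ex_series_le u M H HM). Qed.

(** Dominated convergence: the tail is controlled uniformly in [N] by the tail of [M], and the head
    is a finite sum of convergent sequences. *)
Lemma tannery (x : nat -> nat -> R) (l M : nat -> R) :
  ex_series M -> (forall N n, Rabs (x N n) <= M n) ->
  (forall n, is_lim_seq (fun N => x N n) (l n)) ->
  ex_series l /\ is_lim_seq (fun N => Series (x N)) (Series l).
Proof.
  intros HM Hx Hl.
  assert (HlM : forall n, Rabs (l n) <= M n).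
  { intros n.
    assert (H := is_lim_seq_abs _ _ (Hl n)).
    exact (is_lim_seq_le _ _ _ _ (fun N => Hx N n) H (is_lim_seq_const (M n))). }
  assert (Hexl : ex_series l) by exact (dominated_ex_series _ _ HM HlM).
  split; [exact Hexl|].
  assert (Hexx : forall N, ex_series (x N))
    by (intros N; exact (dominated_ex_series _ _ HM (Hx N))).
  set (y := fun N n => Rabs (x N n - l n)).
  assert (Hy : forall N n, Rabs (y N n) <= 2 * M n).
  { intros N n. unfold y. rewrite Rabs_Rabsolu.
    assert (H1 := Rabs_triang (x N n) (- l n)). rewrite Rabs_Ropp in H1.
    assert (H2 := Hx N n). assert (H3 := HlM n).
    replace (x N n - l n) with (x N n + - l n) by ring. lra. }
  assert (HM2 : ex_series (fun n => 2 * M n)) by exact (ex_series_scal_l 2 M HM).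
  assert (Hexy : forall N, ex_series (y N))
    by (intros N; exact (dominated_ex_series _ _ HM2 (Hy N))).
  apply is_lim_seq_spec. intros eps.
  destruct HM as [SM HSM].
  assert (HSM' := proj1 (is_series_sum_f_R0 _ _) HSM).
  apply is_lim_seq_spec in HSM'.
  (* The head will contribute less than [eps / 4]; the tail of [M] is below [eps / 4], so that of
     [y], bounded by [2 * M], is below [eps / 2]. *)
  assert (He : 0 < eps / 4) by (destruct eps; simpl; lra).
  destruct (HSM' (mkposreal _ He)) as [K HK]. simpl in HK.
  assert (Hfin : is_lim_seq (fun N => sum_f_R0 (y N) K) 0).
  { replace 0 with (sum_f_R0 (fun _ => 0) K)
      by (rewrite sum_cte; ring).
    apply (is_lim_seq_sum_f_R0 y (fun _ => 0)). intros n _.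
    unfold y.
    replace (Finite 0) with (Rbar_abs (Finite (l n - l n)))
      by (simpl; f_equal; rewrite Rminus_diag; apply Rabs_R0).
    apply is_lim_seq_abs, is_lim_seq_minus'; [apply Hl | apply is_lim_seq_const]. }
  apply is_lim_seq_spec in Hfin.
  destruct (Hfin (mkposreal _ He)) as [N0 HN0]. simpl in HN0.
  exists N0. intros N HN.
  rewrite <- Series_minus by auto.
  eapply Rle_lt_trans; [apply Series_Rabs; apply Hexy|].
  change (Series (y N) < eps).
  rewrite (Series_incr_n (y N) (S K)); [simpl | lia | apply Hexy].
  assert (Htail : Series (fun k => y N (S (K + k))) <= Series (fun k => 2 * M (S (K + k))%nat)).
  { apply Series_le.
    - intros n; split; [apply Rabs_pos|].
      eapply Rle_trans; [apply Rle_abs | apply Hy].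
    - exact (proj1 (ex_series_incr_n _ (S K)) HM2). }
  rewrite Series_scal_l in Htail.
  assert (HT := Series_incr_n M (S K) ltac:(lia) (ex_intro _ _ HSM)).
  rewrite (is_series_unique _ _ HSM) in HT. simpl in HT.
  specialize (HK K ltac:(lia)). specialize (HN0 N HN).
  apply Rabs_def2 in HK. apply Rabs_def2 in HN0. lra.
Qed.

(* [binom n k] vanishes for [k > n], unlike [Binomial.C]. *)
Fixpoint binom (n k : nat) : R :=
  match n, k with
  | _, O => 1
  | O, S _ => 0
  | S n', S k' => binom n' k' + binom n' (S k')
  end.

Lemma binom_gt (n k : nat) : (n < k)%nat -> binom n k = 0.
Proof.
  revert k; induction n as [|n IH]; intros [|k] H; simpl; try lia; auto.
  rewrite !IH by lia. ring.
Qed.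

Lemma binom_pos (n k : nat) : (k <= n)%nat -> 0 < binom n k.
Proof.
  revert k; induction n as [|n IH]; intros [|k] H; simpl; try lra; try lia.
  destruct (Nat.eq_dec k n) as [->|Hk].
  - rewrite (binom_gt n (S n)) by lia. specialize (IH n ltac:(lia)). lra.
  - assert (H1 := IH k ltac:(lia)). assert (H2 := IH (S k) ltac:(lia)). lra.
Qed.

Lemma binom_0_r (n : nat) : binom n 0 = 1.
Proof. destruct n; reflexivity. Qed.

Lemma binom_absorb (n k : nat) :
  INR (S k) * binom (S n) (S k) = INR (S n) * binom n k.
Proof.
  revert k; induction n as [|n IH]; intros k.
  - destruct k as [|k]; simpl; ring.
  - change (binom (S (S n)) (S k)) with (binom (S n) k + binom (S n) (S k)).
    rewrite Rmult_plus_distr_l, IH.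
    destruct k as [|k].
    + rewrite !binom_0_r. rewrite !S_INR; simpl; ring.
    + rewrite (S_INR (S k)), Rmult_plus_distr_r, IH, Rmult_1_l.
      rewrite (S_INR (S n)). simpl binom. ring.
Qed.

Lemma sum_binom_succ (f : nat -> R) (N : nat) :
  sum_f_R0 (fun k => binom (S N) k * f k) (S N) =
  sum_f_R0 (fun k => binom N k * (f k + f (S k))) N.
Proof.
  rewrite (decomp_sum _ (S N)) by lia. simpl pred.
  assert (E : sum_f_R0 (fun k => binom N k * f k) (S N) =
              sum_f_R0 (fun k => binom N k * f k) N)
    by (simpl; rewrite (binom_gt N (S N)) by lia; ring).
  rewrite (decomp_sum _ (S N)) in E by lia. simpl pred in E.
  rewrite (sum_eq (fun k => binom N k * (f k + f (S k)))
             (fun k => binom N k * f k + binom N k * f (S k))) by (intros; ring).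
  rewrite plus_sum, <- E.
  rewrite (sum_eq (fun i => binom (S N) (S i) * f (S i))
             (fun i => binom N (S i) * f (S i) + binom N i * f (S i)))
    by (intros; simpl; ring).
  rewrite plus_sum, !binom_0_r. simpl. ring.
Qed.

(** * Moment arrays and their Bernstein sums *)

(** Integrated form of [s^k (1-s)^j = s^(k+1) (1-s)^j + s^k (1-s)^(j+1)]. By Hausdorff's moment
    theorem such arrays are exactly the mixed moments of positive measures on [0,1], so no measure
    has to be constructed. *)
Definition pascal_array (P : nat -> nat -> R) : Prop :=
  (forall k j, 0 <= P k j) /\ (forall k j, P k j = P (S k) j + P k (S j)).

(* The [N]-th Bernstein approximation to the integral of [phi] over [0,1]
   against the measure with mixed moments [P k j], the integrals of
   [s^k (1-s)^j]. *)
Definition bern (P : nat -> nat -> R) (phi : R -> R) (N : nat) : R :=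
  sum_f_R0 (fun k => binom N k * P k (N - k)%nat * phi (INR k / INR N)) N.

(** The binomial theorem [(s + (1-s))^N = 1], integrated: the Bernstein weights have the same total
    mass for every [N]. *)
Lemma sum_binom_pascal (P : nat -> nat -> R) (N : nat) :
  pascal_array P -> sum_f_R0 (fun k => binom N k * P k (N - k)%nat) N = P O O.
Proof.
  intros [_ HP]; induction N as [|N IH].
  - simpl. ring.
  - rewrite (sum_binom_succ (fun k => P k (S N - k)%nat)).
    rewrite <- IH. apply sum_eq. intros k Hk.
    rewrite (HP k (N - k)%nat). replace (S N - k)%nat with (S (N - k)) by lia.
    replace (S N - S k)%nat with (N - k)%nat by lia. ring.
Qed.

Lemma pow_unit (s : R) (n : nat) : 0 <= s <= 1 -> 0 <= s ^ n <= 1.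
Proof.
  intros Hs. split; [apply pow_le; lra|].
  rewrite <- (pow1 n). apply pow_incr, Hs.
Qed.

Lemma node_unit (k N : nat) : (k <= N)%nat -> 0 <= INR k / INR N <= 1.
Proof.
  intros H. destruct (Nat.eq_dec N 0) as [->|HN].
  (* For [N = 0] the only node is [0 / 0], which is [0 * / 0], hence [0] whatever [/ 0] is. *)
  - replace k with O by lia. unfold Rdiv; simpl; lra.
  - assert (0 < INR N) by (apply lt_0_INR; lia).
    assert (INR k <= INR N) by (apply le_INR; lia).
    assert (0 <= INR k) by apply pos_INR.
    split; [apply Rdiv_le_0_compat; auto|].
    apply Rmult_le_reg_r with (INR N); auto. field_simplify; lra.
Qed.

Lemma bern_weight_nonneg (P : nat -> nat -> R) (N k : nat) :
  pascal_array P -> (k <= N)%nat -> 0 <= binom N k * P k (N - k)%nat.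
Proof.
  intros [HP _] H. apply Rmult_le_pos; auto. apply Rlt_le, binom_pos, H.
Qed.

Lemma bern_ext (P : nat -> nat -> R) (phi psi : R -> R) (N : nat) :
  (forall s, 0 <= s <= 1 -> phi s = psi s) -> bern P phi N = bern P psi N.
Proof.
  intros H. apply sum_eq. intros k Hk. rewrite H; auto. apply node_unit, Hk.
Qed.

Lemma bern_le (P : nat -> nat -> R) (phi psi : R -> R) (N : nat) :
  pascal_array P ->
  (forall s, 0 <= s <= 1 -> phi s <= psi s) -> bern P phi N <= bern P psi N.
Proof.
  intros HP H. apply sum_Rle. intros k Hk.
  apply Rmult_le_compat_l; [apply bern_weight_nonneg; auto|].
  apply H, node_unit, Hk.
Qed.

Lemma bern_const (P : nat -> nat -> R) (m : R) (N : nat) :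
  pascal_array P -> bern P (fun _ => m) N = m * P O O.
Proof.
  intros HP. unfold bern. rewrite <- (sum_binom_pascal P N HP), scal_sum.
  reflexivity.
Qed.

Lemma bern_abs_le (P : nat -> nat -> R) (phi : R -> R) (m : R) (N : nat) :
  pascal_array P ->
  (forall s, 0 <= s <= 1 -> Rabs (phi s) <= m) ->
  Rabs (bern P phi N) <= m * P O O.
Proof.
  intros HP H. apply Rabs_le.
  rewrite <- Ropp_mult_distr_l_reverse, <- !(bern_const P _ N HP).
  split; apply bern_le; auto; intros s Hs;
    specialize (H s Hs); apply Rabs_le_between in H; lra.
Qed.

Lemma bern_minus (P : nat -> nat -> R) (phi psi : R -> R) (N : nat) :
  bern P (fun s => phi s - psi s) N = bern P phi N - bern P psi N.
Proof.
  unfold bern. rewrite <- minus_sum. apply sum_eq. intros; ring.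
Qed.

Lemma bern_scal (P : nat -> nat -> R) (m : R) (phi : R -> R) (N : nat) :
  bern P (fun s => m * phi s) N = m * bern P phi N.
Proof.
  unfold bern. rewrite scal_sum. apply sum_eq. intros; ring.
Qed.

Lemma pascal_array_shift (P : nat -> nat -> R) :
  pascal_array P -> pascal_array (fun k => P (S k)).
Proof. intros [H1 H2]; split; intros; [apply H1 | apply H2]. Qed.

(* The nodes [(k+1)/(N+1)] of the shifted formula are within [1/N] of the
   nodes [k/N]. *)
Lemma bern_pow_cvg (n : nat) : forall P, pascal_array P ->
  is_lim_seq (bern P (fun s => s ^ n)) (P n O).
Proof.
  induction n as [|n IH]; intros P HP.
  - apply is_lim_seq_ext with (fun _ => P O O); [|apply is_lim_seq_const].
    intros N. simpl. rewrite (bern_const P 1 N HP). ring.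
  - apply is_lim_seq_incr_1.
    assert (HP' := pascal_array_shift P HP).
    set (P' := fun k => P (S k)) in *.
    set (r := fun N => sum_f_R0 (fun k => binom N k * P' k (N - k)%nat *
       ((INR (S k) / INR (S N)) ^ n - (INR k / INR N) ^ n)) N).
    (* Absorption: one factor [(k+1)/(N+1)] of the power turns row [S N] of the binomials into row
       [N], acting on the shifted array with one degree less. [r] collects the error from the change
       of nodes. *)
    assert (E : forall N, bern P (fun s => s ^ S n) (S N) =
                bern P' (fun s => s ^ n) N + r N).
    { intros N. unfold bern, r. rewrite <- plus_sum, decomp_sum by lia.
      simpl pred.
      replace (binom (S N) 0 * P 0%nat (S N - 0)%nat * (INR 0 / INR (S N)) ^ S n) with 0
        by (simpl; unfold Rdiv; ring).
      rewrite Rplus_0_l. apply sum_eq. intros k Hk.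
      replace (S N - S k)%nat with (N - k)%nat by lia. unfold P'.
      assert (HN : INR (S N) <> 0) by (apply not_0_INR; lia).
      replace ((INR (S k) / INR (S N)) ^ S n)
        with (INR (S k) / INR (S N) * (INR (S k) / INR (S N)) ^ n) by (simpl; ring).
      replace (binom (S N) (S k) * P (S k) (N - k)%nat *
        (INR (S k) / INR (S N) * (INR (S k) / INR (S N)) ^ n))
        with ((INR (S k) * binom (S N) (S k)) * (P (S k) (N - k)%nat / INR (S N)
              * (INR (S k) / INR (S N)) ^ n)) by (field; auto).
      rewrite binom_absorb. field; auto. }
    apply is_lim_seq_ext with (fun N => bern P' (fun s => s ^ n) N + r N);
      [intros; symmetry; apply E|].
    replace (P (S n) O) with (P' n O + 0) by (unfold P'; ring).
    apply is_lim_seq_plus'; [apply IH, HP'|].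
    apply is_lim_seq_abs_0.
    apply is_lim_seq_le_le_loc with (fun _ => 0) (fun N => INR n * P' O O * / INR N).
    + exists 1%nat. intros N HN. split; [apply Rabs_pos|].
      unfold r. eapply Rle_trans; [apply Rsum_abs|].
      rewrite <- (sum_binom_pascal P' N HP').
      replace (INR n * sum_f_R0 (fun k => binom N k * P' k (N - k)%nat) N * / INR N)
        with (INR n / INR N * sum_f_R0 (fun k => binom N k * P' k (N - k)%nat) N)
        by (unfold Rdiv; ring).
      rewrite scal_sum. apply sum_Rle. intros k Hk.
      rewrite Rabs_mult.
      rewrite (Rabs_pos_eq (binom N k * _)) by (apply bern_weight_nonneg; auto).
      apply Rmult_le_compat_l; [apply bern_weight_nonneg; auto|].
      assert (Hs := node_unit k N Hk).
      assert (Ht := node_unit (S k) (S N) ltac:(lia)).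
      assert (HN0 : 0 < INR N) by (apply lt_0_INR; lia).
      assert (Hst : 0 <= INR (S k) / INR (S N) - INR k / INR N <= / INR N).
      { assert (INR k <= INR N) by (apply le_INR; lia).
        assert (0 <= INR k) by apply pos_INR.
        rewrite !S_INR.
        replace ((INR k + 1) / (INR N + 1) - INR k / INR N)
          with ((INR N - INR k) / (INR N + 1) * / INR N) by (field; lra).
        assert (0 < / INR N) by (apply Rinv_0_lt_compat; auto).
        assert (0 <= (INR N - INR k) / (INR N + 1) <= 1).
        { split; [apply Rdiv_le_0_compat; lra|].
          apply Rmult_le_reg_r with (INR N + 1); [lra|]. field_simplify; lra. }
        split; nra. }
      revert Hs Ht Hst. generalize (INR k / INR N), (INR (S k) / INR (S N)).
      intros s t Hs Ht Hst. clear - Hs Ht Hst HN0.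
      assert (Hm : forall m, 0 <= t ^ m - s ^ m <= INR m / INR N).
      { induction m as [|m IHm]; [simpl; unfold Rdiv; rewrite Rmult_0_l; lra|].
        rewrite S_INR. simpl.
        assert (H := pow_unit s m Hs).
        replace (t * t ^ m - s * s ^ m) with (t * (t ^ m - s ^ m) + (t - s) * s ^ m) by ring.
        replace ((INR m + 1) / INR N) with (INR m / INR N + / INR N) by (field; lra).
        split; nra. }
      rewrite Rabs_pos_eq; apply Hm.
    + apply is_lim_seq_const.
    + replace (Finite 0) with (Rbar_mult (INR n * P' O O) 0) by (simpl; f_equal; ring).
      apply is_lim_seq_scal_l.
      replace (Finite 0) with (Rbar_inv p_infty) by reflexivity.
      apply is_lim_seq_inv; [apply is_lim_seq_INR | discriminate].
Qed.

Lemma bern_monomial_cvg (P : nat -> nat -> R) (j : nat) : pascal_array P -> forall n,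
  is_lim_seq (bern P (fun s => s ^ n * (1 - s) ^ j)) (P n j).
Proof.
  intros HP; induction j as [|j IH]; intros n.
  - apply is_lim_seq_ext with (bern P (fun s => s ^ n)); [|apply bern_pow_cvg, HP].
    intros N. apply bern_ext. intros; simpl; ring.
  - apply is_lim_seq_ext with (fun N => bern P (fun s => s ^ n * (1 - s) ^ j) N
        - bern P (fun s => s ^ S n * (1 - s) ^ j) N).
    + intros N. rewrite <- bern_minus. apply bern_ext. intros; simpl; ring.
    + replace (P n (S j)) with (P n j - P (S n) j) by (rewrite (proj2 HP n j); ring).
      apply is_lim_seq_minus'; apply IH.
Qed.

(** Each [bern P _ N] is a positive functional of mass [P O O], so a sup bound on [g i] dominates
    the [i]-th term uniformly in [N] and [tannery] applies. Convergence for general continuous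
    functions is thereby avoided. *)
Lemma bern_series (P : nat -> nat -> R) (g : nat -> R -> R) (M : nat -> R)
    (phi : R -> R) (l : nat -> R) :
  pascal_array P -> ex_series M ->
  (forall i s, 0 <= s <= 1 -> Rabs (g i s) <= M i) ->
  (forall s, 0 <= s <= 1 -> is_series (fun i => g i s) (phi s)) ->
  (forall i, is_lim_seq (bern P (g i)) (l i)) ->
  ex_series l /\ is_lim_seq (bern P phi) (Series l).
Proof.
  intros HP HM Hg Hphi Hl.
  assert (Hs : forall N, is_series (fun i => bern P (g i) N) (bern P phi N)).
  { intros N.
    apply is_series_sum_f_R0.
    apply is_lim_seq_ext with
      (fun n => bern P (fun s => sum_f_R0 (fun i => g i s) n) N).
    - intros n. induction n as [|n IHn]; simpl; [apply bern_ext; auto|].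
      rewrite <- IHn. unfold bern. rewrite <- plus_sum. apply sum_eq; intros; ring.
    - unfold bern.
      apply (is_lim_seq_sum_f_R0 (fun n k => binom N k * P k (N - k)%nat *
            sum_f_R0 (fun i => g i (INR k / INR N)) n)
            (fun k => binom N k * P k (N - k)%nat * phi (INR k / INR N))).
      intros k Hk. apply (is_lim_seq_scal_l _ _ (Finite _)).
      apply is_series_sum_f_R0, Hphi, node_unit, Hk. }
  destruct (tannery (fun N i => bern P (g i) N) l (fun i => M i * P O O)) as [H1 H2].
  - exact (ex_series_scal_r (P O O) M HM).
  - intros N i. apply bern_abs_le; auto.
  - exact Hl.
  - split; auto. apply is_lim_seq_ext with (2 := H2).
    intros N. apply is_series_unique, Hs.
Qed.

(** * The binomial series *)

Lemma poch_pos (x : R) (n : nat) : 0 < x -> 0 < poch x n.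
Proof.
  intros Hx; induction n as [|n IH]; simpl; [lra|].
  apply Rmult_lt_0_compat; auto. assert (H := pos_INR n). lra.
Qed.

(** The coefficient of [y^n] in [(1-y)^(-alpha)]. *)
Definition bcoef (alpha : R) (n : nat) : R := poch alpha n / INR (fact n).

Lemma bcoef_succ (alpha : R) (n : nat) :
  INR (S n) * bcoef alpha (S n) = (alpha + INR n) * bcoef alpha n.
Proof.
  unfold bcoef. rewrite fact_simpl, mult_INR. simpl poch.
  field. split; [apply INR_fact_neq_0 | apply not_0_INR; lia].
Qed.

Lemma bcoef_pos (alpha : R) (n : nat) : 0 < alpha -> 0 < bcoef alpha n.
Proof.
  intros H. apply Rdiv_lt_0_compat; [apply poch_pos, H | apply INR_fact_lt_0].
Qed.

(** The added [1] keeps the parameter of the majorant positive even at [alpha = 0], so that its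
    coefficients never vanish and the ratio test can be applied to them. *)
Lemma bcoef_abs_le (alpha : R) (n : nat) :
  Rabs (bcoef alpha n) <= bcoef (Rabs alpha + 1) n.
Proof.
  unfold bcoef. assert (Hf := INR_fact_lt_0 n).
  unfold Rdiv. rewrite Rabs_mult, (Rabs_pos_eq (/ _))
    by (apply Rlt_le, Rinv_0_lt_compat, Hf).
  apply Rmult_le_compat_r; [apply Rlt_le, Rinv_0_lt_compat, Hf|].
  induction n as [|n IH]; simpl; [rewrite Rabs_R1; lra|].
  rewrite Rabs_mult. specialize (IH (INR_fact_lt_0 n)).
  apply Rmult_le_compat; try apply Rabs_pos; auto.
  eapply Rle_trans; [apply Rabs_triang|].
  rewrite (Rabs_pos_eq (INR n)) by apply pos_INR. lra.
Qed.

Lemma ex_series_bcoef (A y : R) :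
  0 < A -> 0 <= y < 1 -> ex_series (fun n => bcoef A n * y ^ n).
Proof.
  (* At [y = 0] the terms vanish and have no ratios; the test is run at the midpoint [t > 0] between
     [y] and [1], and the series at [y] is compared with it. *)
  intros HA Hy. set (t := (y + 1) / 2).
  assert (Ht : 0 < t < 1) by (unfold t; lra).
  assert (Hyt : y <= t) by (unfold t; lra).
  assert (Hpos : forall n, 0 < bcoef A n * t ^ n)
    by (intros n; apply Rmult_lt_0_compat; [apply bcoef_pos, HA | apply pow_lt; lra]).
  apply (dominated_ex_series _ (fun n => Rabs (bcoef A n * t ^ n))).
  - apply ex_series_DAlembert with t; [lra | intros n; specialize (Hpos n); lra|].
    apply is_lim_seq_ext with (fun n => (1 + (A - 1) * / INR (S n)) * t).
    + intros n. rewrite Rabs_pos_eq by (apply Rlt_le, Rdiv_lt_0_compat; apply Hpos).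
      assert (H := bcoef_succ A n). assert (Hp := bcoef_pos A n HA).
      assert (HS : INR (S n) <> 0) by (apply not_0_INR; lia).
      assert (Hp2 := pow_lt t n ltac:(lra)).
      replace (bcoef A (S n)) with ((A + INR n) * bcoef A n / INR (S n))
        by (rewrite <- H; field; auto).
      simpl pow. rewrite S_INR in *. field. repeat split; lra.
    + replace (Finite t) with (Rbar_mult (1 + (A - 1) * 0) t)
        by (simpl; f_equal; ring).
      apply (is_lim_seq_scal_r _ t (Finite _)).
      apply is_lim_seq_plus'; [apply is_lim_seq_const|].
      apply (is_lim_seq_scal_l _ _ (Finite 0)).
      replace (Finite 0) with (Rbar_inv p_infty) by reflexivity.
      apply is_lim_seq_inv; [|discriminate].
      apply (is_lim_seq_incr_1 INR), is_lim_seq_INR.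
  - intros n. rewrite !Rabs_mult. apply Rmult_le_compat_l; [apply Rabs_pos|].
    rewrite <- !RPow_abs. apply pow_incr.
    rewrite !Rabs_pos_eq by lra. lra.
Qed.

Lemma ex_series_bcoef_abs (alpha y : R) :
  Rabs y < 1 -> ex_series (fun n => Rabs (bcoef alpha n * y ^ n)).
Proof.
  intros Hy. apply (dominated_ex_series _ (fun n => bcoef (Rabs alpha + 1) n * Rabs y ^ n)).
  - apply ex_series_bcoef; [|split; auto; apply Rabs_pos].
    assert (H := Rabs_pos alpha). lra.
  - intros n. rewrite Rabs_Rabsolu, Rabs_mult, <- RPow_abs.
    apply Rmult_le_compat_r; [apply pow_le, Rabs_pos | apply bcoef_abs_le].
Qed.

Lemma CV_radius_bcoef (alpha y : R) :
  Rabs y < 1 -> Rbar_lt (Rabs y) (CV_radius (bcoef alpha)).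
Proof.
  intros Hy. set (r := (Rabs y + 1) / 2).
  assert (H0 := Rabs_pos y).
  assert (Hr : Rabs y < r < 1) by (unfold r; lra).
  apply Rbar_lt_le_trans with r; [simpl; lra|].
  apply (proj1 (Lub_Rbar_correct (CV_disk (bcoef alpha)))).
  apply ex_series_bcoef_abs. rewrite Rabs_pos_eq; lra.
Qed.

(* [f = sum (alpha)_n/n! y^n] solves [(1-y) f' = alpha f], so
   [f (1-y)^alpha] is constant. *)
Lemma binomial_series (alpha y : R) :
  Rabs y < 1 ->
  is_series (fun n => bcoef alpha n * y ^ n) (Rpower (1 - y) (- alpha)).
Proof.
  intros Hy.
  assert (Hex : ex_series (fun n => bcoef alpha n * y ^ n))
    by (apply ex_series_Rabs, ex_series_bcoef_abs, Hy).
  set (f := PSeries (bcoef alpha)).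
  set (f' := PSeries (PS_derive (bcoef alpha))).
  assert (Hode : forall t, Rabs t < 1 -> (1 - t) * f' t = alpha * f t).
  { intros t Ht. assert (HR := CV_radius_bcoef alpha t Ht).
    unfold f, f'. rewrite Rmult_minus_distr_r, Rmult_1_l, <- PSeries_incr_1.
    assert (Hd : ex_pseries (PS_derive (bcoef alpha)) t)
      by (apply CV_radius_inside; rewrite CV_radius_derive; exact HR).
    rewrite <- PSeries_minus; [|exact Hd | apply ex_pseries_incr_1, Hd].
    rewrite <- PSeries_scal. apply PSeries_ext. intros n.
    assert (E := bcoef_succ alpha n). destruct n as [|n].
    - change (INR 1 * bcoef alpha 1 - 0 = alpha * bcoef alpha 0).
      rewrite E. simpl. ring.
    - change (INR (S (S n)) * bcoef alpha (S (S n)) - INR (S n) * bcoef alpha (S n)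
              = alpha * bcoef alpha (S n)).
      rewrite E. ring. }
  set (g := fun t => f t * exp (alpha * ln (1 - t))).
  assert (Hg : forall t, Rabs t < 1 -> is_derive g t 0).
  { intros t Ht. assert (Ht' := Rabs_def2 _ _ Ht).
    replace 0 with (f' t * exp (alpha * ln (1 - t))
       + f t * (- alpha / (1 - t) * exp (alpha * ln (1 - t)))).
    - apply (is_derive_mult f (fun t => exp (alpha * ln (1 - t)))).
      + apply is_derive_PSeries, CV_radius_bcoef, Ht.
      + auto_derive; [lra|]. replace (1 + - t) with (1 - t) by ring. field; lra.
      + apply Rmult_comm.
    - assert (E := Hode t Ht).
      replace (f' t) with (alpha * f t / (1 - t)) by (rewrite <- E; field; lra).
      field; lra. }
  assert (Hgy : g y = 1).
  { assert (Hg0 : g 0 = 1).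
    { unfold g, f. rewrite PSeries_0, Rminus_0_r, ln_1, Rmult_0_r, exp_0.
      unfold bcoef; simpl; field. }
    rewrite <- Hg0. apply Rabs_def2 in Hy.
    destruct (Rtotal_order y 0) as [Hlt | [-> | Hgt]]; auto.
    - apply (eq_is_derive g); [|exact Hlt].
      intros t Ht; apply Hg, Rabs_def1; lra.
    - symmetry. apply (eq_is_derive g); [|exact Hgt].
      intros t Ht; apply Hg, Rabs_def1; lra. }
  replace (Rpower (1 - y) (- alpha)) with (Series (fun n => bcoef alpha n * y ^ n));
    [apply Series_correct, Hex|].
  change (f y = Rpower (1 - y) (- alpha)). unfold g in Hgy. unfold Rpower.
  replace (- alpha * ln (1 - y)) with (- (alpha * ln (1 - y))) by ring.
  rewrite exp_Ropp. assert (He := exp_pos (alpha * ln (1 - y))).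
  apply Rmult_eq_reg_r with (exp (alpha * ln (1 - y))); [|lra].
  rewrite Hgy. field; lra.
Qed.

(** * Bernstein sums of the kernel [(1 - s z)^(-a)] *)

Lemma one_minus_mul_pos (s z : R) : 0 <= s <= 1 -> z < 1 -> 0 < 1 - s * z.
Proof. intros Hs Hz. destruct (Rle_lt_dec z 0); nra. Qed.

Lemma exp_le (x y : R) : x <= y -> exp x <= exp y.
Proof. intros [H | ->]; [apply Rlt_le, exp_increasing, H | lra]. Qed.

(** [1 - s z] lies between [1] and [1 - z]. The upper bound dominates the expansions in series; the
    lower one makes [F] positive. *)
Lemma kernel_bounds (a z s : R) : z < 1 -> 0 <= s <= 1 ->
  exp (- (Rabs a * Rabs (ln (1 - z)))) <= Rpower (1 - s * z) (- a)
    <= exp (Rabs a * Rabs (ln (1 - z))).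
Proof.
  intros Hz Hs. assert (Hp := one_minus_mul_pos s z Hs Hz).
  assert (Hl : Rabs (ln (1 - s * z)) <= Rabs (ln (1 - z))).
  { destruct (Rle_lt_dec z 0) as [H|H].
    - assert (0 <= ln (1 - s * z)) by (rewrite <- ln_1; apply ln_le; nra).
      assert (ln (1 - s * z) <= ln (1 - z)) by (apply ln_le; nra).
      rewrite !Rabs_pos_eq; lra.
    - assert (ln (1 - s * z) <= 0) by (rewrite <- ln_1; apply ln_le; nra).
      assert (ln (1 - z) <= ln (1 - s * z)) by (apply ln_le; nra).
      rewrite !Rabs_left1; lra. }
  assert (Ha : Rabs (- a * ln (1 - s * z)) <= Rabs a * Rabs (ln (1 - z))).
  { rewrite Rabs_mult, Rabs_Ropp. apply Rmult_le_compat_l; auto; apply Rabs_pos. }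
  apply Rabs_le_between in Ha. unfold Rpower.
  split; apply exp_le; lra.
Qed.

(* Writing [1-sz = (1-z)(1-(1-s)w)] with [w = -z/(1-z)] in [0,1) makes the
   expansion converge for every [z <= 0]. *)
Lemma bern_kernel_cvg (P : nat -> nat -> R) (alpha z : R) (n : nat) :
  pascal_array P -> z <= 0 ->
  ex_finite_lim_seq (bern P (fun s => s ^ n * Rpower (1 - s * z) (- alpha))).
Proof.
  intros HP Hz. set (w := - z / (1 - z)). set (K := Rpower (1 - z) (- alpha)).
  assert (Hw : 0 <= w < 1).
  { unfold w. split; [apply Rdiv_le_0_compat; lra|].
    apply Rmult_lt_reg_r with (1 - z); [lra|]. field_simplify; lra. }
  assert (HK : 0 < K) by apply exp_pos.
  exists (Series (fun i => (K * bcoef alpha i * w ^ i) * P n i)).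
  apply (bern_series P
    (fun i s => (K * bcoef alpha i * w ^ i) * (s ^ n * (1 - s) ^ i))
    (fun i => K * (bcoef (Rabs alpha + 1) i * w ^ i))); auto.
  - apply (ex_series_scal_l K (fun i => bcoef (Rabs alpha + 1) i * w ^ i)), ex_series_bcoef;
      [assert (H := Rabs_pos alpha); lra | exact Hw].
  - intros i s Hs.
    assert (H1 := pow_unit s n Hs).
    assert (H2 := pow_unit (1 - s) i ltac:(lra)).
    rewrite !Rabs_mult, (Rabs_pos_eq K), (Rabs_pos_eq (s ^ n)),
      (Rabs_pos_eq ((1 - s) ^ i)), (Rabs_pos_eq (w ^ i)) by (try apply pow_le; lra).
    assert (H3 := bcoef_abs_le alpha i). assert (H4 := Rabs_pos (bcoef alpha i)).
    assert (H5 : 0 <= w ^ i) by (apply pow_le; lra).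
    rewrite !Rmult_assoc. apply Rmult_le_compat_l; [lra|].
    rewrite <- !Rmult_assoc.
    assert (H6 : 0 <= Rabs (bcoef alpha i) * w ^ i <= bcoef (Rabs alpha + 1) i * w ^ i).
    { split; [apply Rmult_le_pos; auto | apply Rmult_le_compat_r; auto]. }
    rewrite Rmult_assoc.
    assert (H7 : 0 <= s ^ n * (1 - s) ^ i <= 1) by nra. nra.
  - intros s Hs.
    assert (Hy : Rabs ((1 - s) * w) < 1) by (rewrite Rabs_pos_eq; nra).
    assert (Hb := binomial_series alpha _ Hy).
    apply (is_series_Rmult_l (K * s ^ n)) in Hb.
    replace (s ^ n * Rpower (1 - s * z) (- alpha))
      with (K * s ^ n * Rpower (1 - (1 - s) * w) (- alpha)).
    + apply is_series_Rext with (2 := Hb). intros i.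
      rewrite Rpow_mult_distr. ring.
    + replace (1 - s * z) with ((1 - z) * (1 - (1 - s) * w))
        by (unfold w; field; lra).
      rewrite <- Rpower_mult_distr; [unfold K; ring | lra|].
      apply Rabs_def2 in Hy; lra.
  - intros i.
    apply is_lim_seq_ext with
      (fun N => (K * bcoef alpha i * w ^ i) * bern P (fun s => s ^ n * (1 - s) ^ i) N).
    + intros N; symmetry; apply bern_scal.
    + apply (is_lim_seq_scal_l _ _ (Finite _)), bern_monomial_cvg, HP.
Qed.

(** Factor [1 - s z = (1 - s z0) (1 - s/(1 - s z0) (z - z0))] and apply the binomial series. Since
    [s/(1 - s z0) <= 1/(1 - z0)] on [0,1], it converges uniformly in [s] up to the distance [1 - z0]
    from the singularity at [1]. *)
Lemma bern_kernel_expansion (P : nat -> nat -> R) (a z0 z : R) (m : nat -> R) :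
  pascal_array P -> z0 <= 0 -> Rabs (z - z0) < 1 - z0 ->
  (forall n, is_lim_seq
     (bern P (fun s => s ^ n * Rpower (1 - s * z0) (- (a + INR n)))) (m n)) ->
  exists L : R, is_lim_seq (bern P (fun s => Rpower (1 - s * z) (- a))) L /\
    is_series (fun n => bcoef a n * m n * (z - z0) ^ n) L.
Proof.
  intros HP Hz0 Hz Hm.
  set (K := exp (Rabs a * Rabs (ln (1 - z0)))).
  set (q := Rabs (z - z0) / (1 - z0)).
  assert (Hq : 0 <= q < 1).
  { unfold q. split; [apply Rdiv_le_0_compat; [apply Rabs_pos | lra]|].
    apply Rmult_lt_reg_r with (1 - z0); [lra|]. field_simplify; lra. }
  assert (HK : 0 < K) by apply exp_pos.
  assert (Hsplit : forall s n, 0 <= s <= 1 ->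
    s ^ n * Rpower (1 - s * z0) (- (a + INR n)) =
    Rpower (1 - s * z0) (- a) * (s / (1 - s * z0)) ^ n).
  { intros s n Hs. assert (Hp := one_minus_mul_pos s z0 Hs ltac:(lra)).
    rewrite Ropp_plus_distr, Rpower_plus, (Rpower_Ropp _ (INR n)), Rpower_pow by auto.
    unfold Rdiv. rewrite Rpow_mult_distr, pow_inv. ring. }
  assert (Hratio : forall s, 0 <= s <= 1 ->
    Rabs (s / (1 - s * z0) * (z - z0)) <= q).
  { intros s Hs. assert (Hp := one_minus_mul_pos s z0 Hs ltac:(lra)).
    rewrite Rabs_mult, Rabs_pos_eq by (apply Rdiv_le_0_compat; lra).
    unfold q. rewrite Rmult_comm. unfold Rdiv.
    apply Rmult_le_compat_l; [apply Rabs_pos|].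
    apply Rmult_le_reg_r with ((1 - s * z0) * (1 - z0)); [nra|].
    field_simplify; nra. }
  destruct (bern_series P
    (fun n s => bcoef a n * (z - z0) ^ n
                * (s ^ n * Rpower (1 - s * z0) (- (a + INR n))))
    (fun n => K * (bcoef (Rabs a + 1) n * q ^ n))
    (fun s => Rpower (1 - s * z) (- a))
    (fun n => bcoef a n * (z - z0) ^ n * m n)) as [Hex Hlim]; auto.
  - apply (ex_series_scal_l K (fun i => bcoef (Rabs a + 1) i * q ^ i)), ex_series_bcoef;
      [assert (H := Rabs_pos a); lra | exact Hq].
  - intros n s Hs. rewrite Hsplit by auto.
    replace (bcoef a n * (z - z0) ^ n *
      (Rpower (1 - s * z0) (- a) * (s / (1 - s * z0)) ^ n))
      with (Rpower (1 - s * z0) (- a) *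
        (bcoef a n * (s / (1 - s * z0) * (z - z0)) ^ n))
      by (rewrite Rpow_mult_distr; ring).
    rewrite !Rabs_mult, <- RPow_abs.
    apply Rmult_le_compat; try apply Rabs_pos.
    + apply Rmult_le_pos; [apply Rabs_pos | apply pow_le, Rabs_pos].
    + rewrite Rabs_pos_eq by apply Rlt_le, exp_pos.
      apply kernel_bounds; auto; lra.
    + apply Rmult_le_compat; [apply Rabs_pos | apply pow_le, Rabs_pos
        | apply bcoef_abs_le | apply pow_incr; split; [apply Rabs_pos | auto]].
  - intros s Hs. assert (Hp := one_minus_mul_pos s z0 Hs ltac:(lra)).
    assert (Hy := Hratio s Hs).
    assert (Hb := binomial_series a (s / (1 - s * z0) * (z - z0)) ltac:(lra)).
    apply (is_series_Rmult_l (Rpower (1 - s * z0) (- a))) in Hb.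
    replace (Rpower (1 - s * z) (- a)) with (Rpower (1 - s * z0) (- a) *
      Rpower (1 - s / (1 - s * z0) * (z - z0)) (- a)).
    + apply is_series_Rext with (2 := Hb). intros n.
      rewrite Hsplit, Rpow_mult_distr by auto. ring.
    + rewrite Rpower_mult_distr; auto.
      * f_equal. field. lra.
      * apply Rabs_le_between in Hy; lra.
  - intros n.
    apply is_lim_seq_ext with (fun N => bcoef a n * (z - z0) ^ n *
       bern P (fun s => s ^ n * Rpower (1 - s * z0) (- (a + INR n))) N).
    + intros N; symmetry; apply bern_scal.
    + apply (is_lim_seq_scal_l _ _ (Finite _)), Hm.
  - exists (Series (fun n => bcoef a n * (z - z0) ^ n * m n)). split; auto.
    apply is_series_Rext with (2 := Series_correct _ Hex). intros; ring.
Qed.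

(** * Identity theorem, and identification of the Bernstein limit with [F] *)

(** The constant term is the limit as [h] decreases to 0; dividing by [h] then reaches the next
    coefficient. Only [h > 0] is assumed, because the continuation argument knows equality on one
    side of the centre only. *)
Lemma power_series_zero (r : R) (n : nat) : 0 < r -> forall c : nat -> R,
  (forall h, 0 < h < r -> is_series (fun n => c n * h ^ n) 0) -> c n = 0.
Proof.
  intros Hr.
  assert (H0 : forall c : nat -> R,
    (forall h, 0 < h < r -> is_series (fun n => c n * h ^ n) 0) -> c O = 0).
  { intros c Hc.
    assert (HR : Rbar_lt (Rabs 0) (CV_radius c)).
    { apply Rbar_lt_le_trans with (r / 2); [simpl; rewrite Rabs_R0; lra|].
      apply (proj1 (CV_radius_bounded c)).
      assert (H := ex_series_lim_0 _ (ex_intro _ _ (Hc (r / 2) ltac:(lra)))).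
      destruct (filterlim_bounded (K := R_AbsRing) (V := R_NormedModule)
        (fun n => c n * (r / 2) ^ n) (ex_intro _ 0 H)) as [M HM].
      exists M. exact HM. }
    assert (Hcont := PSeries_continuity c 0 HR).
    apply continuity_pt_filterlim in Hcont.
    rewrite PSeries_0 in Hcont.
    assert (Hu : is_lim_seq (fun k => PSeries c (r / 2 * / INR (S k))) (c O)).
    { apply (filterlim_comp _ _ _ (fun k => r / 2 * / INR (S k)) (PSeries c)
        eventually (locally 0) _); [|exact Hcont].
      change (is_lim_seq (fun k => r / 2 * / INR (S k)) 0).
      replace (Finite 0) with (Rbar_mult (r / 2) (Rbar_inv p_infty))
        by (simpl; f_equal; ring).
      apply is_lim_seq_scal_l, is_lim_seq_inv; [|discriminate].
      apply (is_lim_seq_incr_1 INR), is_lim_seq_INR. }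
    assert (Hu0 : is_lim_seq (fun k => PSeries c (r / 2 * / INR (S k))) 0).
    { apply is_lim_seq_ext with (fun _ => 0); [|apply is_lim_seq_const].
      intros k. symmetry. apply is_series_unique, Hc.
      assert (H1 : 1 <= INR (S k)) by (rewrite S_INR; assert (H := pos_INR k); lra).
      assert (H2 : 0 < / INR (S k)) by (apply Rinv_0_lt_compat; lra).
      assert (H3 : / INR (S k) <= 1) by (rewrite <- Rinv_1; apply Rinv_le_contravar; lra).
      split; nra. }
    apply is_lim_seq_unique in Hu. apply is_lim_seq_unique in Hu0.
    rewrite Hu in Hu0. injection Hu0; auto. }
  induction n as [|n IH]; intros c Hc; [apply H0, Hc|].
  apply (IH (fun k => c (S k))). intros h Hh.
  assert (H : is_series (fun k => c (S k) * h ^ S k) 0).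
  { apply (is_series_incr_1 (fun k => c k * h ^ k)).
    change (is_series (fun k => c k * h ^ k) (0 + c O * h ^ O)).
    rewrite (H0 c Hc), Rmult_0_l, Rplus_0_l. exact (Hc h Hh). }
  apply (is_series_Rmult_l (/ h)) in H. rewrite Rmult_0_r in H.
  apply is_series_Rext with (2 := H). intros k. simpl. field. lra.
Qed.

(** Continuation to the left: let [[-t, 0]] be the maximal interval of agreement. The expansions at
    [-t] agree to its right, so they have equal coefficients and agree to its left too,
    contradicting maximality. *)
Lemma analytic_identity (F H : R -> R) :
  real_analytic_on (fun z => z <= 0) F -> real_analytic_on (fun z => z <= 0) H ->
  (forall z, -1 < z < 1 -> F z = H z) -> forall z, z <= 0 -> F z = H z.
Proof.
  intros HF HH Heq z Hz.
  set (E := fun t => forall x, - t <= x <= 0 -> F x = H x).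
  destruct (Req_dec (F z) (H z)) as [|Hne]; [assumption|exfalso].
  assert (Hb : bound E).
  { exists (- z). intros t Ht. apply Rnot_lt_le. intros Hlt.
    apply Hne, Ht. lra. }
  assert (Hhalf : E (1 / 2)) by (intros x Hx; apply Heq; lra).
  destruct (completeness E Hb (ex_intro _ _ Hhalf)) as [t [Hub Hlub]].
  assert (Ht := Hub _ Hhalf).
  destruct (HF (- t) ltac:(lra)) as [r1 [Hr1 [c1 Hc1]]].
  destruct (HH (- t) ltac:(lra)) as [r2 [Hr2 [c2 Hc2]]].
  (* The cap by [t] keeps [-t + h] negative for [h < r], inside the range where equality is already
     known. *)
  set (r := Rmin (Rmin r1 r2) t).
  assert (Hr : 0 < r) by (unfold r; repeat apply Rmin_pos; lra).
  assert (Hrr : r <= r1 /\ r <= r2 /\ r <= t).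
  { unfold r. assert (A1 := Rmin_l (Rmin r1 r2) t). assert (A2 := Rmin_r (Rmin r1 r2) t).
    assert (A3 := Rmin_l r1 r2). assert (A4 := Rmin_r r1 r2). lra. }
  assert (Hright : forall x, - t < x <= 0 -> F x = H x).
  { intros x Hx. destruct (Req_dec (F x) (H x)) as [|Hnx]; [assumption|exfalso].
    assert (t <= - x); [|lra]. apply Hlub. intros t' Ht'.
    apply Rnot_lt_le. intros Hlt. apply Hnx, Ht'. lra. }
  assert (Hc : forall n, c1 n = c2 n).
  { intros n. apply Rminus_diag_uniq.
    apply (power_series_zero r n Hr (fun n => c1 n - c2 n)). intros h Hh.
    assert (S1 := Hc1 (- t + h)). assert (S2 := Hc2 (- t + h)).
    replace (- t + h - - t) with h in S1, S2 by ring.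
    rewrite Rabs_pos_eq in S1, S2 by lra.
    assert (S3 := is_series_minus _ _ _ _ (S1 ltac:(lra)) (S2 ltac:(lra))).
    rewrite (Hright (- t + h)) in S3 by lra.
    replace 0 with (plus (H (- t + h)) (opp (H (- t + h))))
      by (unfold plus, opp; simpl; ring).
    apply is_series_Rext with (2 := S3). intros k.
    unfold plus, opp; simpl; ring. }
  assert (Hext : E (t + r / 2)).
  { intros x Hx. destruct (Rlt_le_dec (- t) x) as [Hl|Hl]; [apply Hright; lra|].
    assert (Hx1 : Rabs (x - - t) < r) by (apply Rabs_def1; lra).
    rewrite <- (is_series_unique _ _ (Hc1 x ltac:(lra))).
    rewrite <- (is_series_unique _ _ (Hc2 x ltac:(lra))).
    apply Series_ext. intros n. rewrite Hc. reflexivity. }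
  assert (A := Hub _ Hext). lra.
Qed.

(** Expanded around [0], the kernel has the pure moments [P n O] as coefficients, which reproduces
    the hypergeometric series on [(-1,1)]. Expanded around any [z0 <= 0], it shows that the limit
    [H] exists and is analytic there, so the identity theorem covers [z <= -1]. *)
Lemma hyp32_bern_cvg (a b c d e : R) (F : R -> R) (P : nat -> nat -> R) :
  pascal_array P ->
  (forall n, P n O = poch b n * poch c n / (poch d n * poch e n)) ->
  is_3F2 a b c d e F -> forall z, z < 1 ->
  is_lim_seq (bern P (fun s => Rpower (1 - s * z) (- a))) (F z).
Proof.
  intros HP Hmom [Han Hser].
  set (H := fun z => real (Lim_seq (bern P (fun s => Rpower (1 - s * z) (- a))))).
  assert (Hexp : forall z0, z0 <= 0 -> exists c : nat -> R, forall z,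
    Rabs (z - z0) < 1 - z0 ->
    is_lim_seq (bern P (fun s => Rpower (1 - s * z) (- a))) (H z) /\
    is_series (fun n => c n * (z - z0) ^ n) (H z)).
  { intros z0 Hz0.
    set (m := fun n => real (Lim_seq
      (bern P (fun s => s ^ n * Rpower (1 - s * z0) (- (a + INR n)))))).
    exists (fun n => bcoef a n * m n). intros z Hz.
    destruct (bern_kernel_expansion P a z0 z m) as [L [HL1 HL2]]; auto.
    { intros n. apply Lim_seq_correct', bern_kernel_cvg; auto. }
    unfold H. rewrite (is_lim_seq_unique _ _ HL1). auto. }
  assert (Hunit : forall z, -1 < z < 1 -> is_lim_seq
    (bern P (fun s => Rpower (1 - s * z) (- a))) (F z)).
  { intros z Hz.
    destruct (bern_kernel_expansion P a 0 z (fun n => P n O)) as [L [HL1 HL2]]; auto; try lra.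
    { rewrite !Rminus_0_r. apply Rabs_def1; lra. }
    { intros n. apply is_lim_seq_ext with (bern P (fun s => s ^ n)).
      - intros N. apply bern_ext. intros s _. unfold Rpower.
        rewrite Rmult_0_r, Rminus_0_r, ln_1, Rmult_0_r, exp_0. ring.
      - apply bern_pow_cvg, HP. }
    replace (F z) with L; [exact HL1|].
    apply (is_series_unique) in HL2. rewrite <- HL2.
    rewrite <- (is_series_unique _ _ (Hser z Hz)).
    apply Series_ext. intros n. unfold hyp32_term, bcoef.
    rewrite Hmom, Rminus_0_r. unfold Rdiv. rewrite !Rinv_mult. ring. }
  intros z Hz. destruct (Rlt_le_dec (-1) z) as [Hl|Hl]; [apply Hunit; lra|].
  replace (F z) with (H z).
  - destruct (Hexp z ltac:(lra)) as [c' Hc'].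
    apply Hc'. rewrite Rminus_diag, Rabs_R0. lra.
  - symmetry. apply (analytic_identity F H); [| | |lra].
    + intros x Hx. apply Han. lra.
    + intros x Hx. destruct (Hexp x Hx) as [c' Hc'].
      exists (1 - x). split; [lra|]. exists c'. intros y Hy. apply Hc', Hy.
    + intros x Hx. unfold H. rewrite (is_lim_seq_unique _ _ (Hunit x Hx)). reflexivity.
Qed.

(** * Gauss series at 1 and their contiguous ratio *)

Lemma lim_mul_summable_0 (t : nat -> R) (l : R) :
  ex_series t -> is_lim_seq (fun n => INR n * t n) l -> l <= 0.
Proof.
  intros [sigma HS] Hl. apply Rnot_lt_le. intros Hpos.
  apply is_series_sum_f_R0 in HS.
  apply is_lim_seq_spec in HS. apply is_lim_seq_spec in Hl.
  (* With [n t_n > l/2] eventually, each of the [n] terms after index [n] is at least [l/(4n)], so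
     the block adds [l/4]; partial sums within [l/16] of the limit differ by less than [l/8]. *)
  assert (He1 : 0 < l / 2) by lra. assert (He2 : 0 < l / 16) by lra.
  destruct (Hl (mkposreal _ He1)) as [N1 H1]. destruct (HS (mkposreal _ He2)) as [N2 H2].
  simpl in H1, H2.
  set (n := (N1 + N2 + 1)%nat).
  assert (Hn : 0 < INR n) by (apply lt_0_INR; lia).
  assert (Hk : forall k, (k <= n)%nat ->
    INR k * (l / (4 * INR n)) <= sum_f_R0 t (n + k) - sum_f_R0 t n).
  { induction k as [|k IH]; intros Hk.
    - rewrite Nat.add_0_r. simpl. lra.
    - rewrite Nat.add_succ_r, tech5, S_INR. specialize (IH ltac:(lia)).
      assert (Ht : l / (4 * INR n) <= t (S (n + k))).
      { set (m := S (n + k)).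
        assert (Hm := H1 m ltac:(unfold m; lia)). apply Rabs_def2 in Hm.
        assert (Hmn : INR m <= 2 * INR n)
          by (replace (2 * INR n) with (INR (n + n)) by (rewrite plus_INR; ring);
              apply le_INR; unfold m; lia).
        assert (Hm0 : 0 < INR m) by (apply lt_0_INR; unfold m; lia).
        apply Rle_trans with (l / 2 / INR m).
        - apply Rmult_le_reg_r with (4 * INR n * INR m); [nra|].
          field_simplify; nra.
        - apply Rmult_le_reg_r with (INR m); [lra|]. field_simplify; lra. }
      lra. }
  specialize (Hk n (le_n n)).
  replace (INR n * (l / (4 * INR n))) with (l / 4) in Hk by (field; lra).
  assert (A1 := H2 n ltac:(lia)). assert (A2 := H2 (n + n)%nat ltac:(lia)).
  apply Rabs_def2 in A1. apply Rabs_def2 in A2. lra.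
Qed.

(** The [i]-th term of [2F1(u, v; kappa; 1)], and also the coefficient of [(1-s)^i] in
    [2F1(u, v; kappa; 1-s)]. *)
Definition gauss_term (u v kappa : R) (i : nat) : R :=
  poch u i * poch v i / (poch kappa i * INR (fact i)).

Lemma gauss_term_pos (u v kappa : R) (i : nat) :
  0 < u -> 0 < v -> 0 < kappa -> 0 < gauss_term u v kappa i.
Proof.
  intros. apply Rdiv_lt_0_compat; apply Rmult_lt_0_compat;
    try apply poch_pos; auto; apply INR_fact_lt_0.
Qed.

(** Because [kappa = b + u + v], both [(u+i)(v+i) - i(kappa+i)] and [(b+u)(b+v) - b(kappa+i)] equal
    [uv - b i]. The identity yields both the convergence and the value of the contiguous ratio. *)
Lemma gauss_term_telescope (b u v : R) (i : nat) : 0 < b -> 0 < u -> 0 < v ->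
  let kappa := b + u + v in
  INR (S i) * gauss_term u v kappa (S i) - INR i * gauss_term u v kappa i =
  (b + u) * (b + v) * (gauss_term u v kappa i / (kappa + INR i))
    - b * gauss_term u v kappa i.
Proof.
  intros Hb Hu Hv kappa. assert (Hi := pos_INR i).
  assert (Hk : 0 < kappa) by (unfold kappa; lra).
  assert (Hp := poch_pos kappa i Hk). assert (Hf := INR_fact_lt_0 i).
  unfold gauss_term. rewrite fact_simpl, mult_INR. simpl poch. rewrite S_INR.
  field_simplify_eq; [unfold kappa; ring | repeat split; lra].
Qed.

Lemma ex_series_gauss_term (b u v : R) : 0 < b -> 0 < u -> 0 < v ->
  ex_series (gauss_term u v (b + u + v)).
Proof.
  intros Hb Hu Hv. set (kappa := b + u + v). set (t := gauss_term u v kappa).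
  assert (Ht : forall i, 0 < t i) by (intros; apply gauss_term_pos; unfold kappa; lra).
  (* Beyond this index the term with [1/(kappa+i)] uses up at most half of [b t_i]. Then [i t_i]
     decreases by at least [(b/2) t_i] at each step, which bounds the tail sums, as in Raabe's
     test. *)
  destruct (nfloor_ex (2 * (b + u) * (b + v) / b)) as [N [_ HN]].
  { apply Rdiv_le_0_compat; auto. nra. }
  assert (Hdec : forall i, (S N <= i)%nat ->
    b / 2 * t i <= INR i * t i - INR (S i) * t (S i)).
  { intros i Hi. assert (E := gauss_term_telescope b u v i Hb Hu Hv).
    cbv zeta in E. fold kappa t in E.
    assert (HiN : INR N + 1 <= INR i) by (rewrite <- S_INR; apply le_INR, Hi).
    assert (Hk : 0 < kappa + INR i) by (assert (Hp := pos_INR i); unfold kappa; lra).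
    assert (Hle : (b + u) * (b + v) * (t i / (kappa + INR i)) <= b / 2 * t i).
    { apply Rmult_le_reg_r with (kappa + INR i); [lra|].
      replace ((b + u) * (b + v) * (t i / (kappa + INR i)) * (kappa + INR i))
        with ((b + u) * (b + v) * t i) by (field; lra).
      assert (H2 : 2 * (b + u) * (b + v) <= b * (kappa + INR i)).
      { apply Rle_trans with (b * (2 * (b + u) * (b + v) / b)).
        - right; field; lra.
        - apply Rmult_le_compat_l; [lra|]. unfold kappa; lra. }
      specialize (Ht i). nra. }
    lra. }
  apply (ex_series_incr_n t (S N)).
  destruct (ex_finite_lim_seq_incr (sum_f_R0 (fun k => t (S N + k)%nat))
    (2 / b * (INR (S N) * t (S N)))) as [l Hl].
  - intros n. rewrite tech5. assert (H := Ht (S N + S n)%nat). lra.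
  - intros n.
    assert (H : b / 2 * sum_f_R0 (fun k => t (S N + k)%nat) n <=
      INR (S N) * t (S N) - INR (S N + S n) * t (S N + S n)%nat).
    { induction n as [|n IH].
      - simpl sum_f_R0. rewrite Nat.add_0_r. replace (S N + 1)%nat with (S (S N)) by lia.
        apply Hdec. lia.
      - rewrite tech5, Rmult_plus_distr_l.
        assert (H := Hdec (S N + S n)%nat ltac:(lia)).
        replace (S N + S (S n))%nat with (S (S N + S n)) by lia. lra. }
    assert (Hp : 0 <= INR (S N + S n) * t (S N + S n)%nat)
      by (apply Rmult_le_pos; [apply pos_INR | apply Rlt_le, Ht]).
    apply Rmult_le_reg_l with (b / 2); [lra|].
    replace (b / 2 * (2 / b * (INR (S N) * t (S N)))) with (INR (S N) * t (S N))
      by (field; lra).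
    lra.
  - exists l. apply is_series_sum_f_R0, Hl.
Qed.

(* Gauss's value of 2F1 at 1 enters only through the ratio of contiguous values. *)
Lemma gauss_ratio (b u v : R) : 0 < b -> 0 < u -> 0 < v ->
  let kappa := b + u + v in
  (b + u) * (b + v) * Series (fun i => gauss_term u v kappa i / (kappa + INR i)) =
  b * Series (gauss_term u v kappa).
Proof.
  intros Hb Hu Hv kappa. set (t := gauss_term u v kappa).
  assert (Hk : 0 < kappa) by (unfold kappa; lra).
  assert (Ht : forall i, 0 < t i) by (intros; apply gauss_term_pos; auto).
  assert (Hex : ex_series t) by (apply ex_series_gauss_term; auto).
  (* [r i] is [/ kappa] times the term of the contiguous series [2F1(u, v; kappa+1; 1)]. *)
  set (r := fun i => t i / (kappa + INR i)).
  assert (Hexr : ex_series r).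
  { apply (dominated_ex_series _ (fun i => / kappa * t i)).
    - exact (ex_series_scal_l (/ kappa) t Hex).
    - intros i. assert (Hi := pos_INR i). specialize (Ht i).
      unfold r. rewrite Rabs_pos_eq by (apply Rdiv_le_0_compat; lra).
      unfold Rdiv. rewrite Rmult_comm. apply Rmult_le_compat_r; [lra|].
      apply Rinv_le_contravar; lra. }
  assert (Hs : is_series (fun i => (b + u) * (b + v) * r i - b * t i)
    ((b + u) * (b + v) * Series r - b * Series t)).
  { apply (is_series_minus (fun i => (b + u) * (b + v) * r i) (fun i => b * t i));
      apply is_series_Rmult_l, Series_correct; auto. }
  apply is_series_sum_f_R0 in Hs.
  (* The partial sums telescope to [(n+1) t_(n+1)]. Their limit is nonnegative by positivity and
     nonpositive by summability of [t], hence zero. *)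
  apply is_lim_seq_ext with (v := fun n => INR (S n) * t (S n)) in Hs.
  - set (l := (b + u) * (b + v) * Series r - b * Series t) in Hs.
    assert (H1 : 0 <= l).
    { apply (is_lim_seq_le (fun _ => 0) (fun n => INR (S n) * t (S n)) 0 l); auto.
      - intros n. apply Rmult_le_pos; [apply pos_INR | apply Rlt_le, Ht].
      - apply is_lim_seq_const. }
    assert (H2 : l <= 0).
    { apply (lim_mul_summable_0 t); auto. apply is_lim_seq_incr_1, Hs. }
    unfold l in H1, H2. lra.
  - induction n as [|n IH].
    + assert (E := gauss_term_telescope b u v 0 Hb Hu Hv). cbv zeta in E. fold kappa t in E.
      simpl sum_f_R0. unfold r. rewrite <- E. simpl INR. ring.
    + rewrite tech5, IH.
      assert (E := gauss_term_telescope b u v (S n) Hb Hu Hv). cbv zeta in E. fold kappa t in E.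
      unfold r. rewrite <- E. ring.
Qed.

(** * Moments of the mixture of Beta densities *)

Lemma poch_add (x : R) (k i : nat) :
  poch x (i + k) = poch x k * poch (x + INR k) i.
Proof.
  induction i as [|i IH]; simpl; [ring|]. rewrite IH, plus_INR. ring.
Qed.

(* With [u = d-b], [v = e-b], [g = d+e-b-c], the moments
   [(b)_n (c)_n / ((d)_n (e)_n)] are those of the density proportional to
   [s^(c-1) (1-s)^(g-1) 2F1(u,v;g;1-s)]; expanding the 2F1 gives a mixture of
   Beta(c, g+i), and [mix_term] is the [i]-th contribution to the integral of
   [s^k (1-s)^j], up to the factor [Gamma(c) Gamma(g) / Gamma(c+g)]. *)
Definition mix_term (u v g c : R) (k j i : nat) : R :=
  gauss_term u v g i * (poch c k * poch g (i + j) / poch (c + g) (i + j + k)).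

Definition mix (u v g c : R) (k j : nat) : R := Series (mix_term u v g c k j).

Section Mix.

Variables u v g c : R.
Hypotheses (Hu : 0 < u) (Hv : 0 < v) (Hg : 0 < g) (Hc : 0 < c).

Lemma mix_term_pos (k j i : nat) : 0 < mix_term u v g c k j i.
Proof.
  apply Rmult_lt_0_compat; [apply gauss_term_pos; auto|].
  apply Rdiv_lt_0_compat; [apply Rmult_lt_0_compat|]; apply poch_pos; lra.
Qed.

Lemma mix_term_S_r (k j i : nat) :
  mix_term u v g c k (S j) i =
  mix_term u v g c k j i * ((g + INR (i + j)) / (c + g + INR (i + j + k))).
Proof.
  unfold mix_term. rewrite Nat.add_succ_r. simpl poch.
  assert (H := poch_pos (c + g) (i + j + k) ltac:(lra)).
  assert (Hp := pos_INR (i + j + k)). field. lra.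
Qed.

Lemma mix_term_S_l (k j i : nat) :
  mix_term u v g c (S k) j i =
  mix_term u v g c k j i * ((c + INR k) / (c + g + INR (i + j + k))).
Proof.
  unfold mix_term. rewrite Nat.add_succ_r. simpl poch.
  assert (H := poch_pos (c + g) (i + j + k) ltac:(lra)).
  assert (Hp := pos_INR (i + j + k)). field. lra.
Qed.

Lemma mix_term_pascal (k j i : nat) :
  mix_term u v g c k j i = mix_term u v g c (S k) j i + mix_term u v g c k (S j) i.
Proof.
  rewrite mix_term_S_l, mix_term_S_r, (plus_INR (i + j)).
  assert (H1 := pos_INR (i + j)). assert (H2 := pos_INR k). field. lra.
Qed.

Variable b : R.
Hypotheses (Hb : 0 < b) (Hbal : b + u + v = c + g).

(** For [j = 0] the factor [poch g i] cancels, and [Hbal] makes the rest a Gauss series whose lower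
    parameter exceeds [u + v] by [b + k]. *)
Lemma mix_term_0 (k i : nat) :
  mix_term u v g c k 0 i =
  poch c k / poch (c + g) k * gauss_term u v (b + INR k + u + v) i.
Proof.
  unfold mix_term, gauss_term. rewrite Nat.add_0_r, poch_add.
  replace (b + INR k + u + v) with (c + g + INR k) by lra.
  assert (H1 := poch_pos (c + g) k ltac:(lra)).
  assert (H2 := poch_pos (c + g + INR k) i ltac:(assert (H := pos_INR k); lra)).
  assert (H3 := poch_pos g i Hg). assert (H4 := INR_fact_lt_0 i).
  field. lra.
Qed.

(** Only the entry [(0,0)] needs a convergence test: by Pascal's relation between positive terms,
    every other entry is dominated by a neighbour. *)
Lemma ex_series_mix_term (k j : nat) : ex_series (mix_term u v g c k j).
Proof.
  assert (Habs : forall k j i, Rabs (mix_term u v g c k j i) = mix_term u v g c k j i)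
    by (intros; apply Rabs_pos_eq, Rlt_le, mix_term_pos).
  induction k as [|k IH].
  - induction j as [|j IH].
    + apply ex_series_ext with (fun i => 1 * gauss_term u v (b + u + v) i).
      * intros i. rewrite mix_term_0. simpl. rewrite Rplus_0_r. field.
      * apply (ex_series_scal_l 1 (gauss_term u v (b + u + v))).
        apply ex_series_gauss_term; auto.
    + apply (dominated_ex_series _ _ IH). intros i.
      rewrite Habs, (mix_term_pascal 0 j). assert (H := mix_term_pos 1 j i). lra.
  - apply (dominated_ex_series _ _ IH). intros i.
    rewrite Habs, (mix_term_pascal k j). assert (H := mix_term_pos k (S j) i). lra.
Qed.

Lemma mix_pos (k j : nat) : 0 < mix u v g c k j.
Proof.
  unfold mix. rewrite Series_incr_1 by apply ex_series_mix_term.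
  assert (H := mix_term_pos k j 0).
  assert (0 <= Series (fun i => mix_term u v g c k j (S i))); [|lra].
  apply Rle_trans with (Series (fun i => 0 * mix_term u v g c k j (S i)));
    [rewrite Series_scal_l; lra | apply Series_le].
  - intros n. assert (Hn := mix_term_pos k j (S n)). lra.
  - apply (ex_series_incr_1 (mix_term u v g c k j)), ex_series_mix_term.
Qed.

Lemma mix_pascal (k j : nat) :
  mix u v g c k j = mix u v g c (S k) j + mix u v g c k (S j).
Proof.
  unfold mix. rewrite <- Series_plus by apply ex_series_mix_term.
  apply Series_ext. intros i. apply mix_term_pascal.
Qed.

(** Raising [k] by one divides the [i]-th term by [kappa + i] with [kappa = b + k + u + v], up to a
    factor free of [i]; this is [gauss_ratio] at [b + k]. *)
Lemma mix_moment_succ (k : nat) :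
  (b + u + INR k) * (b + v + INR k) * mix u v g c (S k) 0 =
  (b + INR k) * (c + INR k) * mix u v g c k 0.
Proof.
  assert (Hk := pos_INR k).
  assert (Hp := poch_pos (c + g) k ltac:(lra)).
  assert (E := gauss_ratio (b + INR k) u v ltac:(lra) Hu Hv). simpl in E.
  assert (E0 : mix u v g c k 0 =
    poch c k / poch (c + g) k * Series (gauss_term u v (b + INR k + u + v))).
  { unfold mix. rewrite <- Series_scal_l. apply Series_ext. intros i. apply mix_term_0. }
  assert (E1 : mix u v g c (S k) 0 =
    poch c k * (c + INR k) / poch (c + g) k *
    Series (fun i => gauss_term u v (b + INR k + u + v) i / (b + INR k + u + v + INR i))).
  { unfold mix. rewrite <- Series_scal_l. apply Series_ext. intros i.
    rewrite mix_term_S_l, mix_term_0, Nat.add_0_r, plus_INR.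
    assert (Hi := pos_INR i).
    replace (b + INR k + u + v) with (c + g + INR k) by lra.
    field. lra. }
  rewrite E0, E1.
  replace ((b + INR k) * (c + INR k) *
    (poch c k / poch (c + g) k * Series (gauss_term u v (b + INR k + u + v))))
    with (poch c k * (c + INR k) / poch (c + g) k *
      ((b + INR k) * Series (gauss_term u v (b + INR k + u + v)))) by (field; lra).
  rewrite <- E. field; lra.
Qed.

Lemma mix_moment (k : nat) :
  mix u v g c k 0 / mix u v g c 0 0 =
  poch b k * poch c k / (poch (b + u) k * poch (b + v) k).
Proof.
  assert (H0 := mix_pos 0 0).
  induction k as [|k IH]; simpl; [field; lra|].
  assert (Hk := pos_INR k).
  assert (H1 := poch_pos (b + u) k ltac:(lra)).
  assert (H2 := poch_pos (b + v) k ltac:(lra)).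
  assert (E := mix_moment_succ k).
  replace (mix u v g c (S k) 0) with
    ((b + INR k) * (c + INR k) * mix u v g c k 0 / ((b + u + INR k) * (b + v + INR k)))
    by (rewrite <- E; field; lra).
  replace ((b + INR k) * (c + INR k) * mix u v g c k 0 /
    ((b + u + INR k) * (b + v + INR k)) / mix u v g c 0 0)
    with ((b + INR k) * (c + INR k) / ((b + u + INR k) * (b + v + INR k)) *
       (mix u v g c k 0 / mix u v g c 0 0)) by (field; lra).
  rewrite IH. field. lra.
Qed.

End Mix.

(** * Chebyshev inequalities and comparison of the two moment arrays *)

(* Discrete Cauchy-Binet: the difference of the two sides is the sum over
   [i < k] of the products in the hypothesis. *)
Lemma sum_cauchy_binet_le (x y phi psi : nat -> R) (n : nat) :
  (forall i k, (i < k <= n)%nat ->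
     0 <= (y k * x i - x k * y i) * (phi k * psi i - psi k * phi i)) ->
  sum_f_R0 (fun i => y i * psi i) n * sum_f_R0 (fun i => x i * phi i) n <=
  sum_f_R0 (fun i => y i * phi i) n * sum_f_R0 (fun i => x i * psi i) n.
Proof.
  induction n as [|n IH]; intros H; [simpl; lra|].
  assert (IH' := IH ltac:(intros; apply H; lia)).
  assert (Hd : 0 <= sum_f_R0 (fun i => (y (S n) * x i - x (S n) * y i)
    * (phi (S n) * psi i - psi (S n) * phi i)) n)
    by (apply Rle_trans with (sum_f_R0 (fun _ => 0) n);
        [rewrite sum_cte; lra | apply sum_Rle; intros i Hi; apply H; lia]).
  rewrite (sum_eq _ (fun i =>
    (x i * psi i) * (y (S n) * phi (S n)) + (y i * phi i) * (x (S n) * psi (S n))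
    - ((x i * phi i) * (y (S n) * psi (S n)) + (y i * psi i) * (x (S n) * phi (S n)))))
    in Hd by (intros; ring).
  rewrite minus_sum, !plus_sum, <- !scal_sum in Hd.
  rewrite !tech5. nra.
Qed.

Lemma ratio_incr (x y : nat -> R) (N : nat) :
  (forall i, (i <= N)%nat -> 0 < x i) ->
  (forall i, (i < N)%nat -> y i * x (S i) <= y (S i) * x i) ->
  forall i k, (i <= k <= N)%nat -> y i * x k <= y k * x i.
Proof.
  intros Hx Hy i k [Hik HkN]. induction Hik as [|k Hik IH]; [lra|].
  specialize (IH ltac:(lia)). specialize (Hy k ltac:(lia)).
  assert (H1 := Hx i ltac:(lia)). assert (H2 := Hx k ltac:(lia)).
  assert (H3 := Hx (S k) ltac:(lia)).
  apply Rmult_le_reg_r with (x k); [lra|]. nra.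
Qed.

(** The quotient of the entries at [S j] and [j] is the mean of [h i] with weights [mix_term].
    Adding [delta] to [c] lowers [h] pointwise and moves weight towards small [i], where the
    increasing [h] is smaller; both effects lower the mean. *)
Lemma mix_likelihood_ratio (u v g c b delta : R) (k j : nat) :
  0 < u -> 0 < v -> 0 < g -> 0 < c -> 0 < b -> 0 < delta -> b + u + v = c + g ->
  mix u v g (c + delta) k (S j) * mix u v g c k j <=
  mix u v g (c + delta) k j * mix u v g c k (S j).
Proof.
  intros Hu Hv Hg Hc Hb Hd Hbal.
  set (x := mix_term u v g c k j). set (y := mix_term u v g (c + delta) k j).
  assert (Hx : forall i, 0 < x i) by (intros; apply mix_term_pos; auto).
  assert (Hy : forall i, 0 < y i) by (intros; apply mix_term_pos; auto; lra).
  set (h := fun i => (g + INR (i + j)) / (c + g + INR (i + j + k))).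
  assert (Hfin : forall n,
    sum_f_R0 (mix_term u v g (c + delta) k (S j)) n * sum_f_R0 x n <=
    sum_f_R0 y n * sum_f_R0 (mix_term u v g c k (S j)) n).
  { intros n.
    (* First effect: the factor belonging to [c + delta] is replaced by the larger [h i]. *)
    apply Rle_trans with (sum_f_R0 (fun i => y i * h i) n * sum_f_R0 x n).
    { apply Rmult_le_compat_r; [apply cond_pos_sum, (fun i => Rlt_le _ _ (Hx i))|].
      apply sum_Rle. intros i _. rewrite mix_term_S_r by lra.
      apply Rmult_le_compat_l; [apply Rlt_le, Hy|].
      assert (H1 := pos_INR (i + j)). assert (H2 := pos_INR (i + j + k)).
      apply Rmult_le_compat_l; [lra | apply Rinv_le_contravar; lra]. }
    rewrite (sum_eq (mix_term u v g c k (S j)) (fun i => x i * h i))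
      by (intros; apply mix_term_S_r; auto).
    rewrite (sum_eq x (fun i => x i * 1)), (sum_eq y (fun i => y i * 1)) by (intros; ring).
    apply (sum_cauchy_binet_le x y (fun _ => 1) h).
    intros i m [Him _].
    (* Second effect: [y/x] decreases in [i], since consecutive terms have ratio
       [w / (c' + g + l + j + k)] with [w] independent of [c']. *)
    assert (Hyx : x i * y m <= x m * y i).
    { apply (ratio_incr y x m); auto; [|lia]. intros l _.
      assert (E : forall c', 0 < c' -> mix_term u v g c' k j (S l) =
        mix_term u v g c' k j l *
        ((u + INR l) * (v + INR l) / ((g + INR l) * (INR l + 1)) * (g + INR (l + j))
          / (c' + g + INR (l + j + k)))).
      { intros c' Hc'. unfold mix_term, gauss_term.
        rewrite fact_simpl, mult_INR, S_INR. simpl poch.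
        assert (A1 := poch_pos (c' + g) (l + j + k) ltac:(lra)).
        assert (A2 := poch_pos g l Hg). assert (A3 := INR_fact_lt_0 l).
        assert (A4 := pos_INR l). assert (A5 := pos_INR (l + j + k)).
        field. lra. }
      set (w := (u + INR l) * (v + INR l) / ((g + INR l) * (INR l + 1)) * (g + INR (l + j))).
      assert (Hw : 0 <= w).
      { assert (A4 := pos_INR l). assert (A5 := pos_INR (l + j)).
        apply Rmult_le_pos; [apply Rdiv_le_0_compat; nra | lra]. }
      assert (A6 := pos_INR (l + j + k)).
      assert (Hle : w / (c + delta + g + INR (l + j + k)) <= w / (c + g + INR (l + j + k)))
        by (apply Rmult_le_compat_l; [auto | apply Rinv_le_contravar; lra]).
      assert (Ex : x (S l) = x l * (w / (c + g + INR (l + j + k)))) by (apply E; lra).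
      assert (Ey : y (S l) = y l * (w / (c + delta + g + INR (l + j + k))))
        by (apply E; lra).
      rewrite Ex, Ey. assert (Hxy := Rmult_lt_0_compat _ _ (Hx l) (Hy l)). nra. }
    assert (Hh : h i <= h m).
    { unfold h. rewrite !plus_INR.
      assert (A := lt_INR _ _ Him). assert (B0 := pos_INR i).
      assert (B1 := pos_INR j). assert (B2 := pos_INR k).
      assert (Eh : forall r, 0 <= r -> (g + (r + INR j)) / (c + g + (r + INR j + INR k))
        = 1 - (c + INR k) * / (c + g + (r + INR j + INR k))) by (intros; field; lra).
      rewrite !Eh by lra. apply Rplus_le_compat_l, Ropp_le_contravar.
      apply Rmult_le_compat_l; [lra | apply Rinv_le_contravar; lra]. }
    replace ((y m * x i - x m * y i) * (1 * h i - h m * 1))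
      with ((x m * y i - x i * y m) * (h m - h i)) by ring.
    apply Rmult_le_pos; lra. }
  assert (Hser : forall c' b' k' j', 0 < c' -> 0 < b' -> b' + u + v = c' + g ->
    is_lim_seq (sum_f_R0 (mix_term u v g c' k' j')) (mix u v g c' k' j')).
  { intros c' b' k' j' Hc' Hb' Hbal'.
    apply is_series_sum_f_R0, Series_correct, (ex_series_mix_term u v g c') with b'; auto. }
  assert (Hser0 := fun k' j' => Hser c b k' j' Hc Hb Hbal).
  assert (Hser1 := fun k' j' => Hser (c + delta) (b + delta) k' j'
    ltac:(lra) ltac:(lra) ltac:(lra)).
  exact (is_lim_seq_le _ _ _ _ Hfin
    (is_lim_seq_mult' _ _ _ _ (Hser1 k (S j)) (Hser0 k j))
    (is_lim_seq_mult' _ _ _ _ (Hser1 k j) (Hser0 k (S j)))).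
Qed.

(** Passing to mass 1 also cancels the Gamma factor left out of [mix_term]. *)
Lemma pascal_array_normalize (J : nat -> nat -> R) :
  (forall k j, 0 < J k j) -> (forall k j, J k j = J (S k) j + J k (S j)) ->
  pascal_array (fun k j => J k j / J O O).
Proof.
  intros Hpos HJ. split; intros k j.
  - apply Rlt_le, Rdiv_lt_0_compat; apply Hpos.
  - rewrite (HJ k j). unfold Rdiv. ring.
Qed.

(** Adding [delta] to all four parameters leaves [u], [v] and [g] unchanged, so [Q] is the mixture
    of [P] with [c + delta] for [c]: this is the factor [s^delta] in the density. *)
Lemma hyp32_moment_arrays (b c d e delta : R) :
  0 < b -> 0 < c -> 0 < delta -> b < d -> b < e -> 0 < d + e - b - c ->
  exists P Q : nat -> nat -> R,
    pascal_array P /\ pascal_array Q /\ (forall k j, 0 < P k j) /\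
    (forall n, P n O = poch b n * poch c n / (poch d n * poch e n)) /\
    (forall n, Q n O = poch (b + delta) n * poch (c + delta) n /
                       (poch (d + delta) n * poch (e + delta) n)) /\
    (forall k j, Q k (S j) * P k j <= Q k j * P k (S j)).
Proof.
  intros Hb Hc Hdelta Hd He Hg.
  set (u := d - b). set (v := e - b). set (g := d + e - b - c) in *.
  assert (Hu : 0 < u) by (unfold u; lra). assert (Hv : 0 < v) by (unfold v; lra).
  assert (Hbal : b + u + v = c + g) by (unfold u, v, g; ring).
  assert (Hc' : 0 < c + delta) by lra. assert (Hb' : 0 < b + delta) by lra.
  assert (Hbal' : b + delta + u + v = c + delta + g) by lra.
  assert (Hpos := mix_pos u v g c Hu Hv Hg Hc b Hb Hbal).
  assert (Hpos' := mix_pos u v g (c + delta) Hu Hv Hg Hc' (b + delta) Hb' Hbal').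
  exists (fun k j => mix u v g c k j / mix u v g c 0 0).
  exists (fun k j => mix u v g (c + delta) k j / mix u v g (c + delta) 0 0).
  split; [|split; [|split; [|split; [|split]]]].
  - exact (pascal_array_normalize _ Hpos (mix_pascal u v g c Hu Hv Hg Hc b Hb Hbal)).
  - exact (pascal_array_normalize _ Hpos'
      (mix_pascal u v g (c + delta) Hu Hv Hg Hc' (b + delta) Hb' Hbal')).
  - intros k j. apply Rdiv_lt_0_compat; auto.
  - intros n. rewrite (mix_moment u v g c Hu Hv Hg Hc b Hb Hbal n).
    replace (b + u) with d by (unfold u; ring).
    replace (b + v) with e by (unfold v; ring). reflexivity.
  - intros n.
    rewrite (mix_moment u v g (c + delta) Hu Hv Hg Hc' (b + delta) Hb' Hbal' n).
    replace (b + delta + u) with (d + delta) by (unfold u; ring).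
    replace (b + delta + v) with (e + delta) by (unfold v; ring). reflexivity.
  - intros k j.
    assert (H := mix_likelihood_ratio u v g c b delta k j Hu Hv Hg Hc Hb Hdelta Hbal).
    assert (H1 := Rinv_0_lt_compat _ (Hpos O O)).
    assert (H2 := Rinv_0_lt_compat _ (Hpos' O O)).
    assert (H3 := Rmult_lt_0_compat _ _ H1 H2).
    apply (Rmult_le_compat_r _ _ _ (Rlt_le _ _ H3)) in H. unfold Rdiv. lra.
Qed.

(** * Comparison of Bernstein sums, and the monotonicity of [G/F] *)

Lemma bern_ratio_le (P Q : nat -> nat -> R) (phi psi : R -> R) (N : nat) :
  pascal_array P -> pascal_array Q -> (forall k j, 0 < P k j) ->
  (forall k j, Q k (S j) * P k j <= Q k j * P k (S j)) ->
  (forall s t, 0 <= s -> s <= t -> t <= 1 -> psi t * phi s <= phi t * psi s) ->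
  bern Q psi N * bern P phi N <= bern Q phi N * bern P psi N.
Proof.
  intros [_ HP] [_ HQ] Hpos Hlr Hk. unfold bern.
  apply (sum_cauchy_binet_le (fun k => binom N k * P k (N - k)%nat)
    (fun k => binom N k * Q k (N - k)%nat)
    (fun k => phi (INR k / INR N)) (fun k => psi (INR k / INR N))).
  intros i k [Hik HkN].
  assert (Hst : INR i / INR N <= INR k / INR N).
  { apply Rmult_le_compat_r; [|apply le_INR; lia].
    apply Rlt_le, Rinv_0_lt_compat, lt_0_INR. lia. }
  assert (Hs := node_unit i N ltac:(lia)). assert (Ht := node_unit k N HkN).
  specialize (Hk _ _ (proj1 Hs) Hst (proj2 Ht)).
  apply Rmult_le_pos; [|lra].
  assert (H := ratio_incr (fun k => binom N k * P k (N - k)%nat)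
    (fun k => binom N k * Q k (N - k)%nat) N).
  assert (H' : binom N i * Q i (N - i)%nat * (binom N k * P k (N - k)%nat) <=
    binom N k * Q k (N - k)%nat * (binom N i * P i (N - i)%nat)); [|lra].
  apply H; [| |lia].
  - intros l Hl. apply Rmult_lt_0_compat; [apply binom_pos, Hl | apply Hpos].
  - intros l Hl. replace (N - l)%nat with (S (N - S l)) by lia.
    generalize (N - S l)%nat. intros j.
    assert (B1 := binom_pos N l ltac:(lia)). assert (B2 := binom_pos N (S l) Hl).
    assert (E1 := HP l j). assert (E2 := HQ l j). specialize (Hlr l j).
    assert (B := Rmult_lt_0_compat _ _ B1 B2).
    (* Expanding [P l j] and [Q l j] by Pascal's relation cancels [Q l (S j) * P l (S j)] and leaves
       neighbours on the antidiagonal, the entries that one Bernstein sum uses. *)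
    assert (HE : Q l (S j) * P (S l) j <= Q (S l) j * P l (S j)) by nra.
    replace (binom N l * Q l (S j) * (binom N (S l) * P (S l) j))
      with (binom N l * binom N (S l) * (Q l (S j) * P (S l) j)) by ring.
    replace (binom N (S l) * Q (S l) j * (binom N l * P l (S j)))
      with (binom N l * binom N (S l) * (Q (S l) j * P l (S j))) by ring.
    apply Rmult_le_compat_l; lra.
Qed.

(** [(1 - t w)(1 - s z) - (1 - t z)(1 - s w) = (t - s)(z - w) >= 0]; the sign of [a] decides whether
    the power [-a] reverses this. *)
Lemma kernel_cross_mul (a s t z w : R) :
  0 <= s -> s <= t -> t <= 1 -> w <= z -> z < 1 ->
  (0 < a -> Rpower (1 - t * w) (- a) * Rpower (1 - s * z) (- a) <=
            Rpower (1 - t * z) (- a) * Rpower (1 - s * w) (- a)) /\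
  (a < 0 -> Rpower (1 - t * z) (- a) * Rpower (1 - s * w) (- a) <=
            Rpower (1 - t * w) (- a) * Rpower (1 - s * z) (- a)).
Proof.
  intros Hs Hst Ht Hwz Hz.
  assert (H1 := one_minus_mul_pos t w ltac:(lra) ltac:(lra)).
  assert (H2 := one_minus_mul_pos s z ltac:(lra) ltac:(lra)).
  assert (H3 := one_minus_mul_pos t z ltac:(lra) ltac:(lra)).
  assert (H4 := one_minus_mul_pos s w ltac:(lra) ltac:(lra)).
  rewrite !Rpower_mult_distr by auto.
  assert (Hl : ln ((1 - t * z) * (1 - s * w)) <= ln ((1 - t * w) * (1 - s * z)))
    by (apply ln_le; [apply Rmult_lt_0_compat; auto | nra]).
  unfold Rpower. split; intros Ha; apply exp_le; nra.
Qed.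

Lemma bern_kernel_lim_pos (P : nat -> nat -> R) (a z l : R) :
  pascal_array P -> 0 < P O O -> z < 1 ->
  is_lim_seq (bern P (fun s => Rpower (1 - s * z) (- a))) l -> 0 < l.
Proof.
  intros HP H0 Hz Hl. set (m := exp (- (Rabs a * Rabs (ln (1 - z))))).
  apply Rlt_le_trans with (m * P O O).
  - apply Rmult_lt_0_compat; auto. apply exp_pos.
  - apply (is_lim_seq_le (fun _ => m * P O O) _ (m * P O O) l)
      with (2 := is_lim_seq_const _) (3 := Hl).
    intros N. rewrite <- (bern_const P m N HP). apply bern_le; auto.
    intros s Hs. apply kernel_bounds; auto.
Qed.

Theorem theorem6 (a b c d e delta : R) :
  a <> 0 -> d + e - b - c > 0 -> b > 0 -> c > 0 -> delta > 0 ->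
  Rmin b c < Rmin d e ->
  forall F G : R -> R,
    is_3F2 a b c d e F ->
    is_3F2 a (b + delta) (c + delta) (d + delta) (e + delta) G ->
    (0 < a -> forall x y, -1 < x -> x < y ->
        G (- y) / F (- y) <= G (- x) / F (- x)) /\
    (a < 0 -> forall x y, -1 < x -> x < y ->
        G (- x) / F (- x) <= G (- y) / F (- y)).
Proof.
  intros _ Hg Hb Hc Hdelta Hmin F G HF HG.
  assert (Harr : exists P Q : nat -> nat -> R,
    pascal_array P /\ pascal_array Q /\ (forall k j, 0 < P k j) /\
    (forall n, P n O = poch b n * poch c n / (poch d n * poch e n)) /\
    (forall n, Q n O = poch (b + delta) n * poch (c + delta) n /
                       (poch (d + delta) n * poch (e + delta) n)) /\
    (forall k j, Q k (S j) * P k j <= Q k j * P k (S j))).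
  { assert (H1 := Rmin_l d e). assert (H2 := Rmin_r d e).
    (* The moments are symmetric in [b] and [c], while the mixture needs its [b] below both [d] and
       [e]; the smaller of the two takes that place. *)
    destruct (Rle_lt_dec b c) as [Hbc|Hbc].
    - rewrite Rmin_left in Hmin by lra. apply hyp32_moment_arrays; lra.
    - rewrite Rmin_right in Hmin by lra.
      destruct (hyp32_moment_arrays c b d e delta) as (P & Q & H3 & H4 & H5 & H6 & H7 & H8);
        try lra.
      exists P, Q. repeat split; auto; try apply H3; try apply H4;
        intros n; rewrite ?H6, ?H7, (Rmult_comm (poch _ n) (poch _ n)); reflexivity. }
  destruct Harr as (P & Q & HP & HQ & Hpos & HmP & HmQ & Hlr).
  assert (HFl := hyp32_bern_cvg a b c d e F P HP HmP HF).
  assert (HGl := hyp32_bern_cvg a _ _ _ _ G Q HQ HmQ HG).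
  assert (HF0 : forall z, z < 1 -> 0 < F z)
    by (intros z Hz; exact (bern_kernel_lim_pos P a z _ HP (Hpos O O) Hz (HFl z Hz))).
  assert (Hdiv : forall z w, z < 1 -> w < 1 -> G z * F w <= G w * F z ->
    G z / F z <= G w / F w).
  { intros z w Hz Hw H. assert (H1 := HF0 z Hz). assert (H2 := HF0 w Hw).
    apply Rmult_le_reg_r with (F z * F w); [nra|]. field_simplify; lra. }
  split; intros Ha x y Hx Hxy; apply Hdiv; try lra.
  - apply (is_lim_seq_le
      (fun N => bern Q (fun s => Rpower (1 - s * - y) (- a)) N *
                bern P (fun s => Rpower (1 - s * - x) (- a)) N)
      (fun N => bern Q (fun s => Rpower (1 - s * - x) (- a)) N *
                bern P (fun s => Rpower (1 - s * - y) (- a)) N) (Finite _) (Finite _));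
      try (apply is_lim_seq_mult'; (apply HFl || apply HGl); lra).
    intros N. apply bern_ratio_le; auto. intros s t Hs Hst Ht.
    apply (kernel_cross_mul a s t (- x) (- y)); lra.
  - apply (is_lim_seq_le
      (fun N => bern Q (fun s => Rpower (1 - s * - x) (- a)) N *
                bern P (fun s => Rpower (1 - s * - y) (- a)) N)
      (fun N => bern Q (fun s => Rpower (1 - s * - y) (- a)) N *
                bern P (fun s => Rpower (1 - s * - x) (- a)) N) (Finite _) (Finite _));
      try (apply is_lim_seq_mult'; (apply HFl || apply HGl); lra).
    intros N. apply bern_ratio_le; auto. intros s t Hs Hst Ht.
    apply (kernel_cross_mul a s t (- x) (- y)); lra.
Qed.
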